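(* Let $n$ be a positive integer and let $R$ be a nonzero ring. Then $MC_n(R)$ does not have left finite uniform dimension.
   Context: All rings are associative with $1$; modules are left unitary modules. A set $\{M_i\}_{i\in I}$ of submodules of a module $M$ is called independent if $M_j\cap\sum_{i\in I,\,i\ne j}M_i=0$ for all $j\in I$. If there is a maximal finite independent set of submodules of $M$, the cardinality of this set is the uniform dimension of $M$ and is well defined; in this case $M$ is said to have finite uniform dimension. A ring has left finite uniform dimension if it has finite uniform dimension as a left module over itself. $M_m(R)$ is the ring of $m\times m$ matrices over $R$. Identify $M_n(M_{n^k}(R))$ with $M_{n^{k+1}}(R)$ via block matrices. The $n$-matricial closure $MC_n(R)$ is the direct limit of the rings $M_{n^k}(R)$, $k\in\mathbb{N}=\{0,1,2,\dots\}$ (with $M_{n^0}(R)=R$), along the injective ring morphisms $M_{n^k}(R)\to M_{n^{k+1}}(R)$ sending $A$ to the block diagonal matrix with $n$ diagonal blocks equal to $A$.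
   Formalization: The formal theorem assumes n > 1 instead of n a positive integer: for n = 1, MC_1(R) = R, and a field R has left uniform dimension 1, so the claim fails there. *)

(* Defs.v *)
(* [boolp] supplies the boolean reflection [`[< P >]] of a Prop, which allows
   quotienting by an equivalence relation that need not be decidable. *)
From HB Require Import structures.
From mathcomp Require Import all_boot all_order all_algebra.
From mathcomp Require Import generic_quotient boolp.

Set Implicit Arguments.
Unset Strict Implicit.
Unset Printing Implicit Defensive.

Import GRing.Theory.
Local Open Scope ring_scope.
Local Open Scope quotient_scope.

(* Direct limit of a sequence of rings A 0 -> A 1 -> A 2 -> ...: the disjoint
   union of the A k modulo "equal at some later stage". *)
Section DirectLimit.

Variables (A : nat -> pzRingType) (f : forall k, {rmorphism A k -> A k.+1}).

Fixpoint push (d k : nat) (x : A k) : A (d + k) :=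
  if d is d'.+1 then f (d' + k) (push d' x) else x.

(* Transition map A k -> A l; only meaningful when k <= l (junk value 0). *)
Definition trans (k l : nat) (x : A k) : A l :=
  if (k <= l)%N =P true is ReflectT le_kl
  then ecast j (A j) (subnK le_kl) (push (l - k) x) else 0.

Lemma trans_push d k (x : A k) : trans (d + k) x = push d x.
Proof.
rewrite /trans; destruct (_ =P true) as [le_kl|[]]; last exact: leq_addl.
move: (subnK le_kl); rewrite addnK => e.
by rewrite (eq_irrelevance e erefl).
Qed.

Lemma trans_id k (x : A k) : trans k x = x.
Proof. exact: (trans_push 0). Qed.

Lemma transS k l (x : A k) : (k <= l)%N -> trans l.+1 x = f l (trans l x).
Proof.
by move=> /subnK <-; rewrite -[(_ + k).+1]/(_.+1 + k)%N !trans_push.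
Qed.

Lemma trans_trans k l m (x : A k) : (k <= l)%N -> (l <= m)%N ->
  trans m (trans l x) = trans m x.
Proof.
move=> le_kl /subnK <-; elim: (m - l)%N => [|d IHd]; first by rewrite trans_id.
by rewrite !addSn !transS ?IHd ?leq_addl// (leq_trans le_kl) ?leq_addl.
Qed.

Lemma transD k l : {morph @trans k l : x y / x + y}.
Proof.
move=> x y; have [kl|/negP nkl] := boolP (k <= l)%N; last first.
  by rewrite /trans; destruct (_ =P true) => //; rewrite addr0.
rewrite -(subnK kl); elim: (l - k)%N => [|d IHd]; first by rewrite !trans_id.
by rewrite !addSn !transS ?leq_addl// IHd rmorphD.
Qed.

Lemma transM k l : {morph @trans k l : x y / x * y}.
Proof.
move=> x y; have [kl|/negP nkl] := boolP (k <= l)%N; last first.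
  by rewrite /trans; destruct (_ =P true) => //; rewrite mulr0.
rewrite -(subnK kl); elim: (l - k)%N => [|d IHd]; first by rewrite !trans_id.
by rewrite !addSn !transS ?leq_addl// IHd rmorphM.
Qed.

Lemma trans1 k l : (k <= l)%N -> trans l (1 : A k) = 1.
Proof.
move=> /subnK <-; elim: (l - k)%N => [|d IHd]; first by rewrite trans_id.
by rewrite !addSn !transS ?leq_addl// IHd rmorph1.
Qed.

Lemma trans0 k l : trans l (0 : A k) = 0.
Proof. by apply: (@addrI _ (trans l (0 : A k))); rewrite -transD !addr0. Qed.

Lemma transN k l (x : A k) : trans l (- x) = - trans l x.
Proof. by apply: (@addrI _ (trans l x)); rewrite -transD !subrr trans0. Qed.

Definition dl_rel (u v : {k : nat & A k}) : bool :=
  `[< exists m, [/\ (tag u <= m)%N, (tag v <= m)%N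
                  & trans m (tagged u) = trans m (tagged v)] >].

Lemma dl_rel_refl : reflexive dl_rel.
Proof. by move=> u; apply/asboolP; exists (tag u). Qed.

Lemma dl_rel_sym : symmetric dl_rel.
Proof.
by move=> u v; apply/asboolP/asboolP => -[m [? ? e]]; exists m; split.
Qed.

Lemma dl_rel_trans : transitive dl_rel.
Proof.
move=> v u w /asboolP[m [um vm uv]] /asboolP[p [vp wp vw]].
apply/asboolP; exists (m + p)%N.
have [mmp pmp] : ((m <= m + p)%N * (p <= m + p)%N)%type.
  by rewrite leq_addr leq_addl.
split; [exact: leq_trans mmp|exact: leq_trans pmp|].
rewrite -(trans_trans _ um mmp) uv trans_trans//.
by rewrite -(trans_trans _ vp pmp) vw trans_trans.
Qed.

Canonical dl_equiv := EquivRel dl_rel dl_rel_refl dl_rel_sym dl_rel_trans.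

Definition dirlim : Type := {eq_quot dl_equiv}%qT.
HB.instance Definition _ := Choice.on dirlim.

Definition dl_in (k : nat) (x : A k) : dirlim :=
  \pi_({eq_quot dl_equiv}) (Tagged (fun k => A k : Type) x).

Lemma dl_inP k l (x : A k) (y : A l) :
  dl_in x = dl_in y <->
  exists m, [/\ (k <= m)%N, (l <= m)%N & trans m x = trans m y].
Proof.
rewrite /dl_in; split=> [/eqmodP/asboolP//|xy].
by apply/eqmodP/asboolP.
Qed.

Lemma dl_in_trans k l (x : A k) : (k <= l)%N -> dl_in (trans l x) = dl_in x.
Proof.
by move=> kl; apply/dl_inP; exists l; split=> //; rewrite trans_id.
Qed.

Lemma dl_inS k (x : A k) : dl_in (f k x) = dl_in x.
Proof. by rewrite -(dl_in_trans x (leqnSn k)) transS// trans_id. Qed.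

Lemma dl_ind (P : dirlim -> Prop) :
  (forall k (x : A k), P (dl_in x)) -> forall u, P u.
Proof.
move=> Pin u; rewrite -[u]reprK.
by case: (repr u) => k x; apply: Pin.
Qed.

Lemma dl_ind3 (P : dirlim -> dirlim -> dirlim -> Prop) :
  (forall k (x y z : A k), P (dl_in x) (dl_in y) (dl_in z)) ->
  forall u v w, P u v w.
Proof.
move=> Pin; elim/dl_ind=> k x; elim/dl_ind=> l y; elim/dl_ind=> m z.
have kM : (k <= k + l + m)%N by rewrite -addnA leq_addr.
have lM : (l <= k + l + m)%N by rewrite addnAC leq_addl.
have mM : (m <= k + l + m)%N by rewrite leq_addl.
by rewrite -(dl_in_trans x kM) -(dl_in_trans y lM) -(dl_in_trans z mM).
Qed.

Lemma dl_ind2 (P : dirlim -> dirlim -> Prop) :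
  (forall k (x y : A k), P (dl_in x) (dl_in y)) -> forall u v, P u v.
Proof. by move=> Pin u v; apply: (@dl_ind3 (fun u v _ => P u v) _ u v u). Qed.

Definition dl_lift2 (op : forall k, A k -> A k -> A k) (u v : dirlim) : dirlim :=
  let x := repr u in let y := repr v in
  let m := maxn (tag x) (tag y) in
  dl_in (op m (trans m (tagged x)) (trans m (tagged y))).

Lemma dl_lift2E (op : forall k, A k -> A k -> A k) :
    (forall k l (x y : A k), (k <= l)%N ->
      trans l (op k x y) = op l (trans l x) (trans l y)) ->
  forall k (x y : A k), dl_lift2 op (dl_in x) (dl_in y) = dl_in (op k x y).
Proof.
move=> opE k x y; rewrite /dl_lift2.
case: (repr (dl_in x)) (reprK (dl_in x)) => /= a x' /dl_inP[m [am km xx']].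
case: (repr (dl_in y)) (reprK (dl_in y)) => /= b y' /dl_inP[p [bp kp yy']].
set q := maxn a b; apply/dl_inP; exists (q + (m + p))%N.
have mM : (m <= q + (m + p))%N by rewrite addnCA leq_addr.
have pM : (p <= q + (m + p))%N by rewrite addnA leq_addl.
have qM : (q <= q + (m + p))%N by rewrite leq_addr.
have kM := leq_trans km mM.
rewrite !opE// !trans_trans ?leq_maxl ?leq_maxr//; split=> //.
rewrite -(trans_trans x' am mM) -(trans_trans y' bp pM) xx' yy'.
by rewrite !trans_trans.
Qed.

Definition dl_add := dl_lift2 (fun k x y => x + y).
Definition dl_mul := dl_lift2 (fun k x y => x * y).
Definition dl_opp := dl_lift2 (fun k x y => - x) ^~ (dl_in (0 : A 0)).

Lemma dl_addE k (x y : A k) : dl_add (dl_in x) (dl_in y) = dl_in (x + y).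
Proof. by apply: dl_lift2E => *; rewrite transD. Qed.

Lemma dl_mulE k (x y : A k) : dl_mul (dl_in x) (dl_in y) = dl_in (x * y).
Proof. by apply: dl_lift2E => *; rewrite transM. Qed.

Lemma dl_in0 k : dl_in (0 : A k) = dl_in (0 : A 0).
Proof. by apply/dl_inP; exists k; rewrite !trans0. Qed.

Lemma dl_in1 k : dl_in (1 : A k) = dl_in (1 : A 0).
Proof. by apply/dl_inP; exists k; rewrite !trans1. Qed.

Lemma dl_oppE k (x : A k) : dl_opp (dl_in x) = dl_in (- x).
Proof.
by rewrite /dl_opp -(dl_in0 k) dl_lift2E// => *; rewrite transN.
Qed.

Lemma dl_addA : associative dl_add.
Proof. by apply: dl_ind3 => k x y z; rewrite !dl_addE addrA. Qed.

Lemma dl_addC : commutative dl_add.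
Proof. by apply: dl_ind2 => k x y; rewrite !dl_addE addrC. Qed.

Lemma dl_add0 : left_id (dl_in (0 : A 0)) dl_add.
Proof. by elim/dl_ind=> k x; rewrite -(dl_in0 k) dl_addE add0r. Qed.

Lemma dl_addN : left_inverse (dl_in (0 : A 0)) dl_opp dl_add.
Proof. by elim/dl_ind=> k x; rewrite dl_oppE dl_addE addNr dl_in0. Qed.

HB.instance Definition _ :=
  GRing.isZmodule.Build dirlim dl_addA dl_addC dl_add0 dl_addN.

Lemma dl_mulA : associative dl_mul.
Proof. by apply: dl_ind3 => k x y z; rewrite !dl_mulE mulrA. Qed.

Lemma dl_mul1 : left_id (dl_in (1 : A 0)) dl_mul.
Proof. by elim/dl_ind=> k x; rewrite -(dl_in1 k) dl_mulE mul1r. Qed.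

Lemma dl_mulr1 : right_id (dl_in (1 : A 0)) dl_mul.
Proof. by elim/dl_ind=> k x; rewrite -(dl_in1 k) dl_mulE mulr1. Qed.

Lemma dl_mulDl : left_distributive dl_mul +%R.
Proof.
by apply: dl_ind3 => k x y z; rewrite /+%R/= !(dl_addE, dl_mulE) mulrDl.
Qed.

Lemma dl_mulDr : right_distributive dl_mul +%R.
Proof.
by apply: dl_ind3 => k x y z; rewrite /+%R/= !(dl_addE, dl_mulE) mulrDr.
Qed.

HB.instance Definition _ := GRing.Zmodule_isPzRing.Build dirlim
  dl_mulA dl_mul1 dl_mulr1 dl_mulDl dl_mulDr.

Lemma dl_in_zmod_morphism k : zmod_morphism (@dl_in k).
Proof. by move=> x y; rewrite -dl_addE -dl_oppE. Qed.

Lemma dl_in_monoid_morphism k : monoid_morphism (@dl_in k).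
Proof. by split=> [|x y]; [exact: dl_in1|rewrite -dl_mulE]. Qed.

HB.instance Definition _ k :=
  GRing.isZmodMorphism.Build (A k) dirlim (@dl_in k) (@dl_in_zmod_morphism k).
HB.instance Definition _ k :=
  GRing.isMonoidMorphism.Build (A k) dirlim (@dl_in k)
    (@dl_in_monoid_morphism k).

Lemma dl_in_inj k :
  (forall l, injective (f l)) -> injective (@dl_in k).
Proof.
move=> f_inj x y /dl_inP[m [km _]].
rewrite -(subnK km) !trans_push; elim: (m - k)%N => //= d IHd /f_inj; exact.
Qed.

Lemma dirlim_universal (T : pzRingType) (g : forall k, {rmorphism A k -> T}) :
    (forall k (x : A k), g k.+1 (f k x) = g k x) ->
  exists! h : dirlim -> T,
    [/\ zmod_morphism h, monoid_morphism h
      & forall k (x : A k), h (dl_in x) = g k x].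
Proof.
move=> gf; pose h (u : dirlim) := g (tag (repr u)) (tagged (repr u)).
have gtr k l (x : A k) : (k <= l)%N -> g l (trans l x) = g k x.
  move=> /subnK <-; elim: (l - k)%N => [|d IHd]; first by rewrite trans_id.
  by rewrite addSn transS ?leq_addl// gf.
have hE k (x : A k) : h (dl_in x) = g k x.
  rewrite /h.
  case: (repr (dl_in x)) (reprK (dl_in x)) => /= a x' /dl_inP[m [am km xx']].
  by rewrite -(gtr a m)// -(gtr k m)// xx'.
exists h; split; last first.
  move=> h' [_ _ h'E]; apply/funext; elim/dl_ind => k x.
  by rewrite hE h'E.
split=> //.
- apply: dl_ind2 => k x y.
  by rewrite -(rmorphB (@dl_in k)) !hE rmorphB.
- split; first by rewrite -(rmorph1 (@dl_in 0)) hE rmorph1.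
  apply: dl_ind2 => k x y.
  by rewrite -(rmorphM (@dl_in k)) !hE rmorphM.
Qed.

End DirectLimit.

Section MatricialClosure.

Variables (n : nat) (R : pzRingType).

Lemma block_sizeE k : (\sum_(i < n) n ^ k = n ^ k.+1)%N.
Proof. by rewrite sum_nat_const card_ord expnS. Qed.

(* Block (i, j) of the mxdiag, i.e. rows i * n ^ k + _ and columns
   j * n ^ k + _, is A if i = j and 0 otherwise. *)
Definition block_diag k (A : 'M[R]_(n ^ k)) : 'M[R]_(n ^ k.+1) :=
  castmx (block_sizeE k, block_sizeE k) (\mxdiag_(i < n) A).

Lemma block_diag_zmod_morphism k : zmod_morphism (@block_diag k).
Proof.
move=> A B; rewrite /block_diag mxdiagB; move: (block_sizeE k) => e.
by case: _ / e; rewrite !castmx_id.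
Qed.

Lemma block_diag_monoid_morphism k : monoid_morphism (@block_diag k).
Proof.
rewrite /block_diag; move: (block_sizeE k) => e.
split=> [|A B]; case: _ / e; rewrite !castmx_id; first exact: mxdiagZ.
rewrite /GRing.mul/= [X in _ = _ *m X]/mxdiag mul_mxdiag_mxblock.
apply/eq_mxblock => i j; case: eqVneq => _; last by rewrite mulmx0.
by rewrite !conform_mx_id.
Qed.

HB.instance Definition _ k := GRing.isZmodMorphism.Build
  'M[R]_(n ^ k) 'M[R]_(n ^ k.+1) (@block_diag k) (@block_diag_zmod_morphism k).
HB.instance Definition _ k := GRing.isMonoidMorphism.Build
  'M[R]_(n ^ k) 'M[R]_(n ^ k.+1) (@block_diag k)
  (@block_diag_monoid_morphism k).

Lemma block_diag_inj k : (0 < n)%N -> injective (@block_diag k).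
Proof.
move=> n0 A B; rewrite /block_diag; move: (block_sizeE k) => e.
by case: _ / e; rewrite !castmx_id => /eq_mxdiagP/(_ (Ordinal n0)).
Qed.

Definition block_diag_rmorphism k :
  {rmorphism 'M[R]_(n ^ k) -> 'M[R]_(n ^ k.+1)} := @block_diag k.

Definition MC : pzRingType := dirlim block_diag_rmorphism.

Definition MC_in k : {rmorphism 'M[R]_(n ^ k) -> MC} :=
  (@dl_in _ block_diag_rmorphism k : {rmorphism _ -> dirlim _}).

Lemma MC_in_block_diag k (A : 'M[R]_(n ^ k)) :
  MC_in k.+1 (block_diag A) = MC_in k A.
Proof. exact: (@dl_inS _ block_diag_rmorphism). Qed.

Lemma MC_in_inj k : (0 < n)%N -> injective (MC_in k).
Proof. by move=> n0; apply: dl_in_inj => l; apply: block_diag_inj. Qed.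

Lemma MC_in_surj (u : MC) : exists k (A : 'M[R]_(n ^ k)), u = MC_in k A.
Proof. by elim/dl_ind: u => k A; exists k, A. Qed.

End MatricialClosure.

(* Submodules are [submod_closed] predicates; they are boolean-valued, but by
   [boolp] every Prop-valued subset is of this form. *)
Section UniformDimension.

Variables (R : pzRingType) (M : lmodType R).

(* x is a finite sum of elements of the N i, i != j; repetitions in s are
   harmless for submodules N i. *)
Definition in_sum_others (I : eqType) (N : I -> {pred M}) (j : I) (x : M) :=
  exists (s : seq I) (y : I -> M),
    (forall i, i \in s -> i != j /\ y i \in N i) /\ x = \sum_(i <- s) y i.

Definition independent (I : eqType) (N : I -> {pred M}) :=
  forall (j : I) (x : M), x \in N j -> in_sum_others N j x -> x = 0.

(* Submodules in the families are required to be nonzero, since otherwise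
   padding with 0 would make every cardinality possible; members of such an
   independent family are automatically pairwise distinct. *)
Definition indep_family (I : eqType) (N : I -> {pred M}) :=
  [/\ forall i, submod_closed (N i),
      forall i, exists2 x, x \in N i & x != 0
    & independent N].

(* "Maximal" refers to cardinality. *)
Definition uniform_dim (d : nat) :=
  (exists N : 'I_d -> {pred M}, indep_family N) /\
  forall (k : nat) (N : 'I_k -> {pred M}), indep_family N -> (k <= d)%N.

Definition finite_uniform_dim := exists d, uniform_dim d.

End UniformDimension.

Definition left_finite_uniform_dim (R : pzRingType) := finite_uniform_dim R^o.

(* Main.v *)
(* The images in MC_n(R) of the diagonal matrix units of M_{n^k}(R) are n^k
   nonzero orthogonal idempotents, and they generate an independent family of
   left ideals. Since n > 1, the number n^k is unbounded in k. *)
Require Import Defs.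
From mathcomp Require Import all_boot all_algebra.

Set Implicit Arguments.
Unset Strict Implicit.
Unset Printing Implicit Defensive.

Import GRing.Theory.
Local Open Scope ring_scope.

(** The predicates are the left ideals [S * e i]. Right multiplication by [e j] fixes the ideal of
    index [j] and kills all the others. *)
Lemma indep_family_idempotents (S : pzRingType) (I : eqType) (e : I -> S) :
    (forall i, e i != 0) -> (forall i, e i * e i = e i) ->
    (forall i j, i != j -> e i * e j = 0) ->
  indep_family (fun i => [pred x : S^o | (x : S) * e i == x]).
Proof.
move=> e_neq0 e_idem e_orth; split=> [i|i|j x].
- split=> [|a x y]; rewrite !inE; first by rewrite mul0r.
  by move=> /eqP xe /eqP ye; rewrite mulrDl -mulrA xe ye.
- by exists (e i); rewrite // inE e_idem.
- rewrite inE => /eqP xe [s [y [yP x_sum]]].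
  rewrite -xe x_sum mulr_suml big_seq big1 // => i /yP[i_neq_j].
  by rewrite inE => /eqP <-; rewrite -mulrA e_orth ?mulr0.
Qed.

Lemma MC_indep_family (n : nat) (R : nzRingType) (k : nat) : (0 < n)%N ->
  exists N : 'I_(n ^ k) -> {pred (MC n R)^o}, indep_family N.
Proof.
move=> n_gt0.
eexists; apply: (@indep_family_idempotents (MC n R) _
  (fun i => MC_in n R k (delta_mx i i))) => [i|i|i j i_neq_j].
(* [MC_in] is injective, so it suffices that the matrix unit has an entry [1 != 0]. *)
- rewrite -(rmorph0 (MC_in n R k)) (inj_eq (MC_in_inj n_gt0)).
  apply/eqP => /matrixP/(_ i i)/eqP.
  by rewrite !mxE !eqxx oner_eq0.
- by rewrite -rmorphM; congr (MC_in n R k _); apply: mul_delta_mx.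
- rewrite -rmorphM -(rmorph0 (MC_in n R k)); congr (MC_in n R k _).
  exact: mul_delta_mx_0.
Qed.

(** For [n = 1] the closure is a copy of [R], which may have finite uniform dimension. *)
Theorem corollary8 (n : nat) (R : nzRingType) (n_gt1 : (1 < n)%N) :
  ~ left_finite_uniform_dim (MC n R).
Proof.
move=> [d [_ d_max]].
(* Stage [d] is large enough, as [d < n ^ d]. *)
have [N N_indep] := @MC_indep_family n R d (ltnW n_gt1).
by have := d_max _ _ N_indep; rewrite leqNgt ltn_expl.
Qed.
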